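(* Let $\underline{A},\overline{A}\in\mathbb{R}^{n\times n}$ with $\underline{A}\le\overline{A}$ (entrywise) and let $\mathbf{A}=\{A\in\mathbb{R}^{n\times n} : \underline{A}\le A\le\overline{A}\}$ be the corresponding interval matrix. Then $\mathbf{A}$ is strongly an $S$-matrix if and only if the system $\underline{A}x>0$, $x>0$ is feasible (has a solution $x\in\mathbb{R}^n$).
   Context: All inequalities between vectors or matrices are entrywise. A matrix property holds strongly for an interval matrix $\mathbf{A}$ if it holds for every $A\in\mathbf{A}$. A matrix $A\in\mathbb{R}^{n\times n}$ is an $S$-matrix if there is $x\in\mathbb{R}^n$ with $x>0$ and $Ax>0$. *)

(* Defs.v *)
From mathcomp Require Import all_boot all_order all_algebra.
From mathcomp Require Import classical_sets reals.

Set Implicit Arguments.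
Unset Strict Implicit.
Unset Printing Implicit Defensive.

Import Order.TTheory GRing.Theory Num.Theory.
Local Open Scope ring_scope.
Local Open Scope classical_set_scope.

Definition entrywise_le (R : realType) (m n : nat) (A B : 'M[R]_(m, n)) : Prop :=
  forall i j, A i j <= B i j.

(* Strict in every entry; this is not the strict part of [entrywise_le]. *)
Definition entrywise_lt (R : realType) (m n : nat) (A B : 'M[R]_(m, n)) : Prop :=
  forall i j, A i j < B i j.

Definition interval_mx (R : realType) (m n : nat) (Al Au : 'M[R]_(m, n)) :
    set 'M[R]_(m, n) :=
  [set A | entrywise_le Al A /\ entrywise_le A Au].

Definition strongly (R : realType) (m n : nat) (P : 'M[R]_(m, n) -> Prop)
    (AA : set 'M[R]_(m, n)) : Prop :=
  forall A, AA A -> P A.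

Definition S_matrix (R : realType) (n : nat) (A : 'M[R]_n) : Prop :=
  exists x : 'cV[R]_n, entrywise_lt 0 x /\ entrywise_lt 0 (A *m x).

(* Main.v *)
Require Import Defs.
From mathcomp Require Import all_boot all_order all_algebra.
From mathcomp Require Import classical_sets reals.

Set Implicit Arguments.
Unset Strict Implicit.
Unset Printing Implicit Defensive.

Import Order.TTheory GRing.Theory Num.Theory.
Local Open Scope ring_scope.

(** For fixed [x > 0] the product [A *m x] is monotone in [A], so [Al] is the worst case: a single
    [x] that works for [Al] certifies every matrix of the interval at once. *)

Theorem proposition1 (R : realType) (n : nat) (Al Au : 'M[R]_n)
    (hA : entrywise_le Al Au) :
  strongly (@S_matrix R n) (interval_mx Al Au) <->
  exists x : 'cV[R]_n, entrywise_lt 0 (Al *m x) /\ entrywise_lt 0 x.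
Proof.
split=> [sA | [x [Alx_gt0 x_gt0]] A [leAlA _]].
  (* [Al] itself lies in the interval, thanks to [hA]. *)
  have [|x [x_gt0 Alx_gt0]] := sA Al; last by exists x.
  by split=> // i j.
exists x; split=> // i j; apply: lt_le_trans (Alx_gt0 i j) _.
(* Termwise comparison of [Al *m x] with [A *m x]; positivity of [x] preserves the inequality. *)
rewrite !mxE; apply: ler_sum => k _; apply: ler_wpM2r (leAlA i k).
by have := x_gt0 k j; rewrite mxE => /ltW.
Qed.
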